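(* Let $(A,\cdot,[-,-])$ be a transposed Poisson algebra. If there is a nondegenerate bilinear form $\mathcal B$ on $A$ that is invariant on both $(A,\cdot)$ and $(A,[-,-])$, i.e. $$\mathcal B(x\cdot y,z)=\mathcal B(x,y\cdot z),\qquad \mathcal B([x,y],z)=\mathcal B(x,[y,z]),\qquad\forall x,y,z\in A,$$ then $[x,y]\cdot z=[x\cdot y,z]=0$ for all $x,y,z\in A$.
   Context: All vector spaces and algebras are finite-dimensional over an algebraically closed field $\mathbb K$ of characteristic zero. Transposed Poisson algebra $(A,\cdot,[-,-])$: $(A,\cdot)$ is a commutative associative algebra, $(A,[-,-])$ is a Lie algebra, and $2z\cdot[x,y]=[z\cdot x,y]+[x,z\cdot y]$ for all $x,y,z\in A$. *)

(* Defs.v *)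
From mathcomp Require Import all_boot all_algebra.

Set Implicit Arguments.
Unset Strict Implicit.
Unset Printing Implicit Defensive.

Import GRing.Theory.
Local Open Scope ring_scope.

Section Algebras.

Variables (K : fieldType) (A : vectType K).
Implicit Types (mul br : {bilinear A -> A -> A}).

(* Algebras are not required to be unital, so MathComp's ring structures do
   not apply; a multiplication is a bare bilinear map. *)
Definition is_comm_assoc_algebra mul : Prop :=
  commutative mul /\ associative mul.

Definition is_Lie_algebra br : Prop :=
  (forall x, br x x = 0) /\
  (forall x y z, br x (br y z) + br y (br z x) + br z (br x y) = 0).

Record is_transposed_Poisson mul br : Prop := IsTransposedPoisson {
  tP_comm_assoc : is_comm_assoc_algebra mul;
  tP_Lie : is_Lie_algebra br;
  tP_compat : forall x y z,
    2%:R *: mul z (br x y) = br (mul z x) y + br x (mul z y) }.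

(* The library's nondegenerate is only available for hermitian forms; here no
   symmetry is assumed, so both radicals are required to vanish. *)
Definition nondegenerate_form (B : {biscalar A}) : Prop :=
  (forall x, (forall y, B x y = 0) -> x = 0) /\
  (forall y, (forall x, B x y = 0) -> y = 0).

Definition invariant_form (B : {biscalar A}) mul : Prop :=
  forall x y z, B (mul x y) z = B x (mul y z).

End Algebras.

(* Main.v *)
(* Moving every argument except x across the form turns the compatibility
   condition into 2 [y, z w] = z [y, w] + [z y, w].  Together with the condition
   itself this gives 3 [y, z w] = 3 [z y, w], hence z [x, y] = [z x, y] = [x, z y].
   Then [x y, z] = [y, x z] = - [z x, y] = - [x, y z] = - [x y, z]. *)
Require Import Defs.
From mathcomp Require Import all_boot all_algebra.
Import GRing.Theory.
Local Open Scope ring_scope.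

(** Serves to cancel the factors 2 and 3; the successor form keeps the scalar nonzero in
    characteristic zero. *)
Lemma scaler_natr_inj {K : fieldType} {V : lmodType K} (n : nat) :
  [pchar K] =i pred0 -> injective (fun v : V => n.+1%:R *: v).
Proof.
by move=> charK0; apply: scalerI; rewrite ((pcharf0P K).1 charK0).
Qed.

(** Polarization: expanding [br (x + y) (x + y) = 0] leaves only the mixed terms. *)
Lemma Lie_anticomm {K : fieldType} {A : vectType K}
    {br : {bilinear A -> A -> A}} (LieA : is_Lie_algebra br) (x y : A) :
  br x y = - br y x.
Proof.
apply/eqP; rewrite -addr_eq0; case: LieA => brxx _.
by have := brxx (x + y); rewrite linearDl !linearDr !brxx add0r addr0 => ->.
Qed.

Section InvariantForm.

Context {K : fieldType} {A : vectType K} {mul br : {bilinear A -> A -> A}}.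
Hypothesis charK0 : [pchar K] =i pred0.
Hypothesis tPA : is_transposed_Poisson mul br.
Context {B : {biscalar A}}.
Hypotheses (ndB : nondegenerate_form B) (mulB : invariant_form B mul)
  (brB : invariant_form B br).

Lemma dual_compat (y z w : A) :
  2%:R *: br y (mul z w) = mul z (br y w) + br (mul z y) w.
Proof.
have [[mulC _] _ compat] := tPA.
apply/eqP; rewrite -subr_eq0; apply/eqP; apply: ndB.2 => x.
apply/eqP; rewrite linearBr subr_eq0 linearZr linearDr /=; apply/eqP.
(* The right side gathers into [B (br (mul z x) y + br x (mul z y)) w], where [compat] applies. *)
rewrite -brB -!mulB -!brB -linearDl (mulC x z) -compat linearZl /=.
by rewrite (mulC z (br x y)) mulB.
Qed.

Lemma br_mulA (x y z : A) : br x (mul z y) = br (mul z x) y.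
Proof.
have [_ _ compat] := tPA.
(* The index is one below the factor: 3 is cancelled. *)
apply: (scaler_natr_inj 2 charK0) => /=.
(* Doubling makes [compat] applicable to 2 z [x, y]; one of the four copies of [x, z y] then
   cancels. *)
have := congr1 ( *:%R 2%:R) (dual_compat x z y).
rewrite scalerDr compat !scaler_nat -mulrnA [_ + br x _]addrC -addrA -mulrS.
by rewrite mulrS => /addrI.
Qed.

Lemma mul_br (x y z : A) : mul z (br x y) = br (mul z x) y.
Proof.
have [_ _ compat] := tPA.
apply: (scaler_natr_inj 1 charK0) => /=.
by rewrite compat br_mulA scaler_nat mulr2n.
Qed.

Lemma br_mul_eq0 (x y z : A) : br (mul x y) z = 0.
Proof.
have [[mulC _] LieA _] := tPA.
have br_mulN : br (mul x y) z = - br (mul x y) z.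
  rewrite -{1}br_mulA (Lie_anticomm LieA) (mulC x z) -br_mulA (mulC z y).
  by rewrite br_mulA (mulC y x).
apply: (scaler_natr_inj 1 charK0) => /=.
by rewrite scaler0 scaler_nat mulr2n {2}br_mulN subrr.
Qed.

End InvariantForm.

Theorem proposition3p22 (K : closedFieldType) (charK0 : [pchar K] =i pred0)
    (A : vectType K) (mul br : {bilinear A -> A -> A})
    (tPA : is_transposed_Poisson mul br)
    (exB : exists B : {biscalar A},
      [/\ nondegenerate_form B, invariant_form B mul & invariant_form B br]) :
  forall x y z : A, mul (br x y) z = 0 /\ br (mul x y) z = 0.
Proof.
have [B [ndB mulB brB]] := exB; have [[mulC _] _ _] := tPA.
(* The first product becomes [br (mul z x) y], so both claims are instances of [br_mul_eq0]. *)
move=> x y z; rewrite mulC (mul_br charK0 tPA ndB mulB brB).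
by rewrite !(br_mul_eq0 charK0 tPA ndB mulB brB).
Qed.
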